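(* Let $n,p,q\ge 1$ be integers, let $X\in\mathbb{R}^{n\times p}$ and $Z\in\mathbb{R}^{n\times q}$ be fixed matrices, and for each value of a parameter vector $\theta$ let $\Lambda_\theta\in\mathbb{R}^{q\times q}$ be a (possibly singular) matrix. Suppose that $y\in\mathbb{R}^n$ is a realization of a random vector $\mathcal{Y}$ satisfying the linear mixed-effects model $$\mathcal{Y}=X\beta+Z\Lambda_\theta\,\mathcal{U}+\varepsilon,\qquad \mathcal{U}\sim\mathcal{N}(\boldsymbol{0},\sigma^2 I_q),\quad \varepsilon\sim\mathcal{N}(\boldsymbol{0},\sigma^2 I_n),\quad \mathcal{U}\text{ and }\varepsilon\text{ independent},$$ where $\beta\in\mathbb{R}^p$, $\theta$ and $\sigma^2>0$ are the parameters to be estimated. Let $L_\theta\in\mathbb{R}^{q\times q}$ be a matrix such that $L_\theta^\top L_\theta=(Z\Lambda_\theta)^\top Z\Lambda_\theta+I_q$, let $\tilde u$ be the conditional mean of $\mathcal{U}$ given $\mathcal{Y}=y$, and let $g(\tilde u)=\|y-X\beta-Z\Lambda_\theta\tilde u\|^2+\|\tilde u\|^2$. Then the profiled log-likelihood of $\beta$ and $\theta$ conditional on $y$ is $$\tilde\ell(\beta,\theta\mid y)=-\frac12\log|L_\theta|^2-\frac n2\left[1+\log\left(\frac{2\pi g(\tilde u)}{n}\right)\right].$$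
   Context: Here $\|\cdot\|$ is the Euclidean norm, $|L_\theta|$ is the (absolute value of the) determinant of $L_\theta$, and $I_m$ is the $m\times m$ identity matrix. The log-likelihood $\ell(\beta,\theta,\sigma^2\mid y)$ is the logarithm of the (marginal) density at $y$ of $\mathcal{Y}$ with respect to Lebesgue measure on $\mathbb{R}^n$, under the parameters $(\beta,\theta,\sigma^2)$. The profiled log-likelihood of $\beta$ and $\theta$ is obtained by profiling out $\sigma^2$, i.e. by maximizing over $\sigma^2$ with $\beta,\theta$ held fixed: $$\tilde\ell(\beta,\theta\mid y)=\sup_{\sigma^2>0}\ell(\beta,\theta,\sigma^2\mid y).$$ The conditional mean $\tilde u=\mathbb{E}[\mathcal{U}\mid\mathcal{Y}=y]$ is taken with respect to the (Gaussian) conditional distribution under the parameters $(\beta,\theta,\sigma^2)$; it depends on $\beta,\theta,y$ but not on $\sigma^2$. In the degenerate case $g(\tilde u)=0$ (that is, $y=X\beta$), the formula is read with the convention $\log 0=-\infty$, both sides being $+\infty$. *)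

(* Defs.v *)
From HB Require Import structures.
From mathcomp Require Import all_boot all_order all_algebra.
From mathcomp Require Import all_classical all_reals all_analysis.

Set Implicit Arguments.
Unset Strict Implicit.
Unset Printing Implicit Defensive.

Import Order.TTheory GRing.Theory Num.Theory.
Import numFieldNormedType.Exports.

Local Open Scope classical_set_scope.
Local Open Scope ring_scope.

Definition mx_display : measure_display -> measure_display.
Proof. exact. Qed.

(* The sigma-algebra generated by the entries; for real entries it is the
   Borel sigma-algebra. *)
Definition mx_measurable d (T : measurableType d) m n : set (set 'M[T]_(m, n)) :=
  <<s \bigcup_(ij in [set: 'I_m * 'I_n])
        preimage_set_system setT (fun M : 'M[T]_(m, n) => M ij.1 ij.2)
          measurable >>.

Lemma mx_measurable0 d (T : measurableType d) m n :
  @mx_measurable d T m n set0.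
Proof. exact: sigma_algebra0. Qed.

Lemma mx_measurableC d (T : measurableType d) m n (A : set 'M[T]_(m, n)) :
  mx_measurable A -> mx_measurable (~` A).
Proof. exact: sigma_algebraC. Qed.

Lemma mx_measurable_bigcup d (T : measurableType d) m n
    (F : (set 'M[T]_(m, n))^nat) :
  (forall i, mx_measurable (F i)) -> mx_measurable (\bigcup_i F i).
Proof. exact: sigma_algebra_bigcup. Qed.

HB.instance Definition _ d (T : measurableType d) m n :=
  @isMeasurable.Build (mx_display d) 'M[T]_(m, n) (@mx_measurable d T m n)
    (@mx_measurable0 d T m n) (@mx_measurableC d T m n)
    (@mx_measurable_bigcup d T m n).

Lemma measurable_mx_entry d (T : measurableType d) m n (i : 'I_m) (j : 'I_n) :
  measurable_fun [set: 'M[T]_(m, n)] (fun M => M i j).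
Proof.
move=> _ A mA; rewrite setTI; apply: sub_sigma_algebra.
by exists (i, j) => //; exists A => //; rewrite setTI.
Qed.

Lemma measurable_fun_mxP d d' (T : measurableType d) (T' : measurableType d')
    m n (f : T' -> 'M[T]_(m, n)) :
  measurable_fun setT f <->
  forall i j, measurable_fun setT (fun x => f x i j).
Proof.
split=> [mf i j|mf _ A mA].
  exact: (measurableT_comp (measurable_mx_entry i j) mf).
rewrite setTI; move: A mA.
suff H : <<s \bigcup_(ij in [set: 'I_m * 'I_n])
    preimage_set_system setT (fun M : 'M[T]_(m, n) => M ij.1 ij.2) measurable >>
    `<=` [set A | measurable (f @^-1` A)] by exact: H.
apply: smallest_sub.
  split=> /=.
  - by rewrite preimage_set0.
  - by move=> A mA; rewrite setTD preimage_setC; exact: measurableC.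
  - by move=> F mF; rewrite preimage_bigcup; exact: bigcup_measurable.
move=> _ [[i j] _ [A mA <-]] /=.
by rewrite setTI -[X in measurable X]setTI; exact: mf.
Qed.

Definition cons_cv (R : realType) k (p : R * 'cV[R]_k) : 'cV[R]_(1 + k) :=
  col_mx (const_mx p.1) p.2.

Lemma measurable_cons_cv (R : realType) k : measurable_fun setT (@cons_cv R k).
Proof.
apply/measurable_fun_mxP => i j; rewrite /cons_cv.
case: (splitP i) => a ia.
- rewrite (_ : (fun _ => _) = (fun p : R * 'cV[R]_k => p.1)).
    exact: measurable_fst.
  apply/funext => p; rewrite (_ : i = lshift k a) ?col_mxEu ?mxE//.
  exact: val_inj.
- rewrite (_ : (fun _ => _) = (fun p : R * 'cV[R]_k => p.2 a j)).
    exact: (measurableT_comp (measurable_mx_entry a j) measurable_snd).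
  apply/funext => p; rewrite (_ : i = rshift 1 a) ?col_mxEd//.
  exact: val_inj.
Qed.

Definition cons_measure (R : realType) k
    (mu : {sigma_finite_measure set 'cV[R]_k -> \bar R}) :
    set 'cV[R]_k.+1 -> \bar R :=
  pushforward (@lebesgue_measure R \x mu)%E (@cons_cv R k).

Lemma cons_measure0 (R : realType) k
    (mu : {sigma_finite_measure set 'cV[R]_k -> \bar R}) :
  cons_measure mu set0 = 0%E.
Proof. by rewrite /cons_measure /pushforward preimage_set0 measure0. Qed.

Lemma cons_measure_ge0 (R : realType) k
    (mu : {sigma_finite_measure set 'cV[R]_k -> \bar R}) A :
  (0 <= cons_measure mu A)%E.
Proof. exact: integral_ge0. Qed.

Lemma cons_measure_sigma_additive (R : realType) k
    (mu : {sigma_finite_measure set 'cV[R]_k -> \bar R}) :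
  semi_sigma_additive (cons_measure mu).
Proof.
move=> F mF tF mUF; rewrite /cons_measure /pushforward preimage_bigcup.
have mpre (A : set 'cV[R]_k.+1) :
    measurable A -> measurable (@cons_cv R k @^-1` A).
  move=> mA; rewrite -[X in measurable X]setTI.
  exact: (@measurable_cons_cv R k).
apply: measure_semi_sigma_additive.
- by move=> i; exact: mpre.
- apply/trivIsetP => /= i j _ _ ij; rewrite -preimage_setI.
  by move/trivIsetP : tF => /(_ _ _ _ _ ij) ->//; rewrite preimage_set0.
- by rewrite -preimage_bigcup; exact: mpre.
Qed.

HB.instance Definition _ (R : realType) k
    (mu : {sigma_finite_measure set 'cV[R]_k -> \bar R}) :=
  isMeasure.Build _ _ _ (cons_measure mu) (cons_measure0 mu)
    (cons_measure_ge0 mu) (@cons_measure_sigma_additive R k mu).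

Lemma measurable_cv_uncons (R : realType) k :
  measurable_fun [set: 'cV[R]_(1 + k)]
    (fun v => (usubmx v 0 0, dsubmx v) : R * 'cV[R]_k).
Proof.
apply/measurable_fun_pairP => /=; split.
  rewrite (_ : _ \o _ = (fun v : 'cV[R]_(1 + k) => v (lshift k 0) 0)).
    exact: measurable_mx_entry.
  by apply/funext => v /=; rewrite mxE.
apply/measurable_fun_mxP => i j.
rewrite (_ : (fun _ => _) = (fun v : 'cV[R]_(1 + k) => v (rshift 1 i) j)).
  exact: measurable_mx_entry.
by apply/funext => v /=; rewrite mxE.
Qed.

Lemma cons_measure_sigma_finite (R : realType) k
    (mu : {sigma_finite_measure set 'cV[R]_k -> \bar R}) :
  sigma_finite setT (cons_measure mu).
Proof.
have /sigma_finiteP[F [FT ndF mF]] := sigma_finiteT (@lebesgue_measure R).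
have /sigma_finiteP[G [GT ndG mG]] := sigma_finiteT mu.
pose h (v : 'cV[R]_(1 + k)) : R * 'cV[R]_k := (usubmx v 0 0, dsubmx v).
exists (fun i => h @^-1` (F i `*` G i)).
  apply/seteqP; split => // v _.
  have [i _ Fi] : (\bigcup_i F i) (h v).1 by rewrite -FT.
  have [j _ Gj] : (\bigcup_i G i) (h v).2 by rewrite -GT.
  exists (maxn i j) => //; split => /=.
    by move: Fi; apply/subsetPset; apply: ndF; exact: leq_maxl.
  by move: Gj; apply/subsetPset; apply: ndG; exact: leq_maxr.
move=> i; split.
  rewrite -[X in measurable X]setTI; apply: (@measurable_cv_uncons R k) => //.
  by apply: measurableX; [exact: (mF i).1|exact: (mG i).1].
rewrite /cons_measure /pushforward.
rewrite (_ : _ @^-1` _ = F i `*` G i).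
  rewrite product_measure1E; [|exact: (mF i).1|exact: (mG i).1].
  by apply: lte_mul_pinfty => //; [rewrite fin_num_abs gee0_abs ?(mF i).2|exact: (mG i).2].
apply/funext => -[x w] /=.
by rewrite /h /cons_cv /= col_mxKu col_mxKd mxE.
Qed.

HB.instance Definition _ (R : realType) k
    (mu : {sigma_finite_measure set 'cV[R]_k -> \bar R}) :=
  Measure_isSigmaFinite.Build _ _ _ (cons_measure mu)
    (cons_measure_sigma_finite mu).

Fixpoint lebesgue_vec (R : realType) (k : nat) :
    {sigma_finite_measure set 'cV[R]_k -> \bar R} :=
  match k return {sigma_finite_measure set 'cV[R]_k -> \bar R} with
  | 0 => \d_(0 : 'cV[R]_0)
  | k.+1 => cons_measure (lebesgue_vec R k)
  end.

Definition is_pdf d (T : measurableType d) (R : realType)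
    (mu law : set T -> \bar R) (f : T -> R) : Prop :=
  [/\ measurable_fun setT f,
      forall x, 0 <= f x &
      forall A, measurable A -> law A = (\int[mu]_(x in A) (f x)%:E)%E].

(* A density is only determined almost everywhere; its value at a point is that
   of the continuous version, which is unique when it exists. *)
Definition density (R : realType) k (law : set 'cV[R]_k -> \bar R) :
    'cV[R]_k -> R :=
  xget (cst 0) [set f | continuous f /\ is_pdf (lebesgue_vec R k) law f].

Definition joint_density (R : realType) k l
    (law : set ('cV[R]_k * 'cV[R]_l) -> \bar R) : 'cV[R]_k * 'cV[R]_l -> R :=
  xget (cst 0) [set f | continuous f /\
    is_pdf (lebesgue_vec R k \x lebesgue_vec R l)%E law f].

(* The density of N(mu, Sigma), for Sigma symmetric positive definite. *)
Definition mvnormal_pdf (R : realType) k (mu : 'cV[R]_k) (Sigma : 'M[R]_k)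
    (x : 'cV[R]_k) : R :=
  (Num.sqrt ((2 * pi) ^+ k * \det Sigma))^-1 *
  expR (- ((x - mu)^T *m invmx Sigma *m (x - mu)) 0 0 / 2).

Definition normally_distributed d (T : measurableType d) (R : realType)
    (P : probability T R) k (V : {RV P >-> 'cV[R]_k})
    (mu : 'cV[R]_k) (Sigma : 'M[R]_k) : Prop :=
  is_pdf (lebesgue_vec R k) (distribution P V) (mvnormal_pdf mu Sigma).

Definition independent d d1 d2 (T : measurableType d) (T1 : measurableType d1)
    (T2 : measurableType d2) (R : realType) (P : probability T R)
    (V : {RV P >-> T1}) (W : {RV P >-> T2}) : Prop :=
  forall A B, measurable A -> measurable B ->
    P (V @^-1` A `&` W @^-1` B) = (P (V @^-1` A) * P (W @^-1` B))%E.

Definition linear_mixed_model d (T : measurableType d) (R : realType) n p q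
    (X : 'M[R]_(n, p)) (Z : 'M[R]_(n, q)) (Lambda : 'M[R]_q)
    (beta : 'cV[R]_p) (sigma2 : R) (P : probability T R)
    (U : {RV P >-> 'cV[R]_q}) (eps Y : {RV P >-> 'cV[R]_n}) : Prop :=
  [/\ forall w, Y w = X *m beta + Z *m Lambda *m U w + eps w,
      normally_distributed U 0 (sigma2%:M),
      normally_distributed eps 0 (sigma2%:M) &
      independent U eps].

Definition loglik d (T : measurableType d) (R : realType) (P : probability T R)
    n (Y : {RV P >-> 'cV[R]_n}) (y : 'cV[R]_n) : \bar R :=
  lne (density (distribution P Y) y)%:E.

Definition profile_out (R : realType) (l : R -> \bar R) : \bar R :=
  ereal_sup [set l sigma2 | sigma2 in [set s : R | 0 < s]].

Definition cond_density d (T : measurableType d) (R : realType)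
    (P : probability T R) q n
    (U : {RV P >-> 'cV[R]_q}) (Y : {RV P >-> 'cV[R]_n}) (y : 'cV[R]_n)
    (u : 'cV[R]_q) : R :=
  joint_density (pushforward P (fun w => (U w, Y w))) (u, y)
  / density (distribution P Y) y.

Definition cond_mean d (T : measurableType d) (R : realType)
    (P : probability T R) q n
    (U : {RV P >-> 'cV[R]_q}) (Y : {RV P >-> 'cV[R]_n}) (y : 'cV[R]_n) :
    'cV[R]_q :=
  \col_i (\int[lebesgue_vec R q]_u (u i 0 * cond_density U Y y u)).

(* The library's norm on matrices is the sup norm. *)
Definition enorm (R : realType) k (v : 'cV[R]_k) : R :=
  Num.sqrt (\sum_i v i 0 ^+ 2).

(* Main.v *)
(* Write A = Z Lambda, b = X beta, r = y - b, M = A^T A + I = L^T L.  Completing the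
   square around the ridge solution u = M^-1 A^T r gives
     |r - A v|^2 + |v|^2 = g(u) + (v - u)^T M (v - u),
   so the joint density of (U, Y) at (v, y) is a function of y times an unnormalised
   N(u, s M^-1) density in v.  Hence u is the conditional mean (reflection around u)
   and, integrating v out, the density of Y is
     (2 pi s)^(-n/2) (det M)^(-1/2) exp (- g(u) / (2 s)),
   which is maximised over s > 0 at s = g(u) / n.  The Gaussian integral is computed
   one coordinate at a time through Schur complements, which avoids the linear change
   of variables formula. *)

Require Import Defs.
From HB Require Import structures.
From mathcomp Require Import all_boot all_order all_algebra.
From mathcomp Require Import all_classical all_reals all_analysis.
From mathcomp Require Import measurable_realfun ring lra.

Set Implicit Arguments.
Unset Strict Implicit.
Unset Printing Implicit Defensive.

Import Order.TTheory GRing.Theory Num.Theory.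
Import numFieldNormedType.Exports.

Local Open Scope classical_set_scope.
Local Open Scope ring_scope.

(** * Lebesgue measure on column vectors *)

Section measurable_mx_fun.
Context d (T : measurableType d) (R : realType).

Lemma measurable_fun_mxD m n (f g : T -> 'M[R]_(m, n)) :
  measurable_fun setT f -> measurable_fun setT g ->
  measurable_fun setT (fun x => f x + g x).
Proof.
move=> /measurable_fun_mxP mf /measurable_fun_mxP mg.
apply/measurable_fun_mxP => i j.
under eq_fun do rewrite mxE.
exact: measurable_funD.
Qed.

Lemma measurable_fun_mxM m n p (f : T -> 'M[R]_(m, n)) (g : T -> 'M[R]_(n, p)) :
  measurable_fun setT f -> measurable_fun setT g ->
  measurable_fun setT (fun x => f x *m g x).
Proof.
move=> /measurable_fun_mxP mf /measurable_fun_mxP mg.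
apply/measurable_fun_mxP => i j.
under eq_fun do rewrite mxE.
by apply: measurable_sum => k; exact: measurable_funM.
Qed.

Lemma measurable_fun_mxN m n (f : T -> 'M[R]_(m, n)) :
  measurable_fun setT f -> measurable_fun setT (fun x => - f x).
Proof.
move=> /measurable_fun_mxP mf; apply/measurable_fun_mxP => i j.
under eq_fun do rewrite mxE.
exact: measurableT_comp.
Qed.

Lemma measurable_fun_tr m n (f : T -> 'M[R]_(m, n)) :
  measurable_fun setT f -> measurable_fun setT (fun x => (f x)^T).
Proof.
move=> /measurable_fun_mxP mf; apply/measurable_fun_mxP => i j.
by under eq_fun do rewrite mxE; exact: mf.
Qed.

Lemma measurable_fun_form k (M : 'M[R]_k) (f : T -> 'cV[R]_k) :
  measurable_fun setT f ->
  measurable_fun setT (fun x => ((f x)^T *m M *m f x) 0 0).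
Proof.
move=> mf.
have : measurable_fun setT (fun x => (f x)^T *m M *m f x).
  apply: measurable_fun_mxM => //; apply: measurable_fun_mxM => //.
  exact: measurable_fun_tr.
by move=> /measurable_fun_mxP; exact.
Qed.

End measurable_mx_fun.

(** * Continuity of matrix operations, entry by entry *)

Section continuous_mx_fun.
Context (T : topologicalType) (R : realType).

Lemma continuous_sum (I : Type) (r : seq I) (f : I -> T -> R) :
  (forall i, continuous (f i)) -> continuous (fun x => \sum_(i <- r) f i x).
Proof.
move=> cf; elim: r => [|i r IH].
  by under eq_fun do rewrite big_nil; move=> x; exact: cvg_cst.
under eq_fun do rewrite big_cons.
by move=> x; apply: cvgD; [exact: cf|exact: IH].
Qed.

Lemma continuous_mulmx_entry m n p (f : T -> 'M[R]_(m, n))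
    (g : T -> 'M[R]_(n, p)) i j :
  (forall i j, continuous (fun x => f x i j)) ->
  (forall i j, continuous (fun x => g x i j)) ->
  continuous (fun x => (f x *m g x) i j).
Proof.
move=> cf cg; under eq_fun do rewrite mxE.
by apply: continuous_sum => k x; apply: cvgM; [exact: cf|exact: cg].
Qed.

Lemma continuous_form k (M : 'M[R]_k) (f : T -> 'cV[R]_k) :
  (forall i j, continuous (fun x => f x i j)) ->
  continuous (fun x => ((f x)^T *m M *m f x) 0 0).
Proof.
move=> cf; apply: continuous_mulmx_entry => // i j.
apply: continuous_mulmx_entry => // i' j'; last by move=> x; exact: cvg_cst.
by under eq_fun do rewrite mxE; exact: cf.
Qed.

End continuous_mx_fun.

(** * Translations and reflections of the line *)

Section lebesgue_affine.
Context (R : realType).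
Local Notation mu := (@lebesgue_measure R).

(** Lebesgue measure is determined by its values on half-open intervals, and the preimage of such an
    interval under a translation has the same length. *)
Lemma lebesgue_measure_shift (c : R) (A : set R) : measurable A ->
  pushforward mu ((fun t => t + c) : _ -> measurableTypeR R) A = mu A.
Proof.
move=> mA; apply/esym.
have mc : measurable_fun setT ((fun t => t + c) : measurableTypeR R -> measurableTypeR R).
  exact: measurable_funD.
apply: (@lebesgue_measure_unique R (pushforward mu ((fun t => t + c) : _ -> measurableTypeR R))) => //= _ [[a b]] _ <-.
rewrite /pushforward.
have -> : (fun t => t + c) @^-1` `]a, b] = `]a - c, b - c]%classic.
  by apply/seteqP; split => t /=; rewrite !in_itv/= ltrBlDr lerBrDr.
rewrite /= !lebesgue_measure_itv/= !lte_fin ltrD2r.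
by case: ifP => // _; rewrite -!EFinD; congr (_%:E); ring.
Qed.

(** The condition [e * e = 1] stands for a sign, so that translations (needed to centre Gaussians)
    and reflections (needed for odd moments) are treated at once. *)
Lemma ge0_integral_affine (e c : R) (f : R -> \bar R) : e * e = 1 ->
  measurable_fun setT f -> (forall t, 0 <= f t)%E ->
  (\int[mu]_t f (e * t + c)%R = \int[mu]_t f t)%E.
Proof.
move=> ee mf f0.
have shift (g : R -> \bar R) : measurable_fun setT g -> (forall t, 0 <= g t)%E ->
    (\int[mu]_t g (t + c)%R = \int[mu]_t g t)%E.
  move=> mg g0.
  have mc : measurable_fun setT ((fun t => t + c) : measurableTypeR R -> measurableTypeR R).
    exact: measurable_funD.
  rewrite -[LHS](@ge0_integral_pushforward _ _ _ _ _ _ mc mu setT g)//.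
  apply: eq_measure_integral => A mA _; exact: lebesgue_measure_shift.
have := mulf_eq0 (e - 1) (e + 1).
have -> : (e - 1) * (e + 1) = 0.
  by transitivity (e * e - 1); [ring|rewrite ee subrr].
rewrite eqxx => /esym/orP[|]; rewrite ?subr_eq0 ?addr_eq0 => /eqP ->.
  by under eq_integral do rewrite mul1r; exact: shift.
under eq_integral do rewrite mulN1r.
(* For [e = -1], the right side is first translated by [c]; the two sides then differ by the
   reflection alone. *)
rewrite -(shift f)//.
have mN : measurable_fun setT (-%R : measurableTypeR R -> measurableTypeR R) by exact: oppr_measurable.
rewrite -[LHS](@ge0_integral_pushforward _ _ _ _ _ _ mN mu setT (fun t => f (t + c)))//.
  apply: eq_measure_integral => A mA _; exact: lebesgue_measureN.
by apply: measurableT_comp => //; exact: measurable_funD.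
Qed.

End lebesgue_affine.

(** * Iterated integrals and affine invariance in dimension [k] *)

Section lebesgue_vec_integral.
Context (R : realType).
Local Notation mu := (@lebesgue_measure R).
Local Notation muv := (lebesgue_vec R).

Lemma ge0_integral_lebesgue_vecS k (f : 'cV[R]_(1 + k) -> \bar R) :
  measurable_fun setT f -> (forall x, 0 <= f x)%E ->
  (\int[muv (1 + k)]_x f x = \int[mu]_t \int[muv k]_w f (cons_cv (t, w)))%E.
Proof.
move=> mf f0.
rewrite [LHS](@ge0_integral_pushforward _ _ (measurableTypeR R * 'cV[R]_k)%type _ R
  _ (@measurable_cons_cv R k) (mu \x muv k)%E setT f)//.
rewrite preimage_setT fubini_tonelli1//=.
exact: (measurableT_comp mf (@measurable_cons_cv R k)).
Qed.

(** The order with the first coordinate innermost is the one in which Gaussian integrals are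
    evaluated. *)
Lemma ge0_integral_lebesgue_vecS2 k (f : 'cV[R]_(1 + k) -> \bar R) :
  measurable_fun setT f -> (forall x, 0 <= f x)%E ->
  (\int[muv (1 + k)]_x f x = \int[muv k]_w \int[mu]_t f (cons_cv (t, w)))%E.
Proof.
move=> mf f0; rewrite ge0_integral_lebesgue_vecS//.
apply: (@fubini_tonelli _ _ _ _ _ mu (muv k) (f \o @cons_cv R k)).
  exact: (measurableT_comp mf (@measurable_cons_cv R k)).
by move=> x; exact: f0.
Qed.

Lemma measurable_cons_cvr k (t : R) :
  measurable_fun setT (fun w : 'cV[R]_k => cons_cv (t, w)).
Proof. exact: (measurableT_comp (@measurable_cons_cv R k) (pair1_measurable t)). Qed.

Lemma measurable_mx_affine k (e : R) (c : 'cV[R]_k) :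
  measurable_fun setT (fun x : 'cV[R]_k => e *: x + c).
Proof.
apply: measurable_fun_mxD => //; apply/measurable_fun_mxP => i j.
under eq_fun do rewrite mxE.
by apply: measurable_funM => //; exact: measurable_mx_entry.
Qed.

(** By induction on the dimension: multiplication by a scalar and translation act on each coordinate
    separately, so Tonelli reduces the claim to the line. *)
Lemma ge0_integral_lebesgue_vec_affine k (e : R) (c : 'cV[R]_k)
    (f : 'cV[R]_k -> \bar R) : e * e = 1 ->
  measurable_fun setT f -> (forall x, 0 <= f x)%E ->
  (\int[muv k]_x f (e *: x + c)%R = \int[muv k]_x f x)%E.
Proof.
move=> ee; elim: k => [|k IH] in c f *.
  by move=> mf f0; apply: eq_integral => x _; congr f; apply/colP => -[].
(* The dimension [k.+1] is restated as the convertible [1 + k], on which block decompositions are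
   typed. *)
suff H (c1 : 'cV[R]_(1 + k)) (f1 : 'cV[R]_(1 + k) -> \bar R) :
    measurable_fun setT f1 -> (forall x, 0 <= f1 x)%E ->
    (\int[muv (1 + k)]_x f1 (e *: x + c1)%R =
     \int[muv (1 + k)]_x f1 x)%E by exact: H.
move: c1 f1 => {}c {}f mf f0.
have mg : measurable_fun setT (fun x : 'cV[R]_(1 + k) => f (e *: x + c)).
  exact: (measurableT_comp mf (measurable_mx_affine e c)).
apply: etrans (ge0_integral_lebesgue_vecS mg (fun x => f0 _)) _.
apply: etrans _ (esym (ge0_integral_lebesgue_vecS mf f0)).
pose c0 : R := usubmx c 0 0.
have E t w : e *: cons_cv (t, w) + c = cons_cv (e * t + c0, e *: w + dsubmx c).
  rewrite /cons_cv/= -[in LHS](vsubmxK c) scale_col_mx add_col_mx; congr col_mx.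
  by apply/matrixP => i j; rewrite !ord1 /c0 !mxE.
transitivity (\int[mu]_t \int[muv k]_w f (cons_cv (e * t + c0, w)%R))%E.
  apply: eq_integral => t _.
  under eq_integral do rewrite E.
  apply: (IH (dsubmx c) (fun w => f (cons_cv (e * t + c0, w)%R))) => //.
  exact: (measurableT_comp mf (measurable_cons_cvr _)).
apply: (@ge0_integral_affine R e c0 (fun t => \int[muv k]_w f (cons_cv (t, w)))%E) => //.
  apply: (@measurable_fun_fubini_tonelli_F _ _ _ _ _ (muv k) (f \o @cons_cv R k)).
    exact: (measurableT_comp mf (@measurable_cons_cv R k)).
  by move=> x; exact: f0.
by move=> t /=; apply: integral_ge0 => w _; exact: f0.
Qed.

Lemma integral_lebesgue_vec_affine k (e : R) (c : 'cV[R]_k)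
    (f : 'cV[R]_k -> \bar R) : e * e = 1 -> measurable_fun setT f ->
  (\int[muv k]_x f (e *: x + c)%R = \int[muv k]_x f x)%E.
Proof.
move=> ee mf; rewrite integralE [RHS]integralE.
congr (_ - _)%E.
- rewrite -(ge0_integral_lebesgue_vec_affine c ee (measurable_funepos mf)
    (funepos_ge0 f)).
  by apply: eq_integral => x _; rewrite !funeposE.
- rewrite -(ge0_integral_lebesgue_vec_affine c ee (measurable_funeneg mf)
    (funeneg_ge0 f)).
  by apply: eq_integral => x _; rewrite !funenegE.
Qed.

End lebesgue_vec_integral.

(** * Gaussian integrals *)

Section gaussian_integral.
Context (R : realType).
Local Notation mu := (@lebesgue_measure R).
Local Notation muv := (lebesgue_vec R).

Definition posdef k (M : 'M[R]_k) : Prop :=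
  M^T = M /\ forall x : 'cV[R]_k, x != 0 -> 0 < (x^T *m M *m x) 0 0.

Lemma mulmx11E (P Q : 'M[R]_1) : (P *m Q) 0 0 = P 0 0 * Q 0 0.
Proof. by rewrite mxE big_ord1. Qed.

(** The Schur complement of the corner [a] in the symmetric block matrix with off-diagonal block [b]
    and lower block [D]. *)
Definition schur k (a : R) (b : 'cV[R]_k) (D : 'M[R]_k) : 'M[R]_k :=
  D - a^-1 *: (b *m b^T).

(** Completes the square in the first coordinate [t]; the Schur complement is what remains on
    [w]. *)
Lemma form_block k (a : R) (b : 'cV[R]_k) (D : 'M[R]_k) (t : R) (w : 'cV[R]_k) :
  a != 0 ->
  ((cons_cv (t, w))^T *m block_mx a%:M b^T b D *m cons_cv (t, w)) 0 0 =
  a * (t + a^-1 * (b^T *m w) 0 0) ^+ 2 + (w^T *m schur a b D *m w) 0 0.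
Proof.
move=> a0; rewrite /cons_cv /schur /=.
have -> : const_mx t = t%:M :> 'M[R]_1.
  by apply/matrixP => i j; rewrite !ord1 !mxE.
rewrite tr_col_mx tr_scalar_mx mul_row_block mul_row_col mulmxBr mulmxBl.
rewrite -scalemxAr -scalemxAl [w^T *m (b *m b^T)]mulmxA -[_ *m b^T *m w]mulmxA.
rewrite !mulmxDl !mul_scalar_mx -!scalemxAl [_ *m t%:M]mul_mx_scalar.
have wb : (w^T *m b) 0 0 = (b^T *m w) 0 0.
  by rewrite -[w^T *m b]trmxK trmx_mul trmxK [LHS]mxE.
have addE (A B : 'M[R]_1) : (A + B) 0 0 = A 0 0 + B 0 0 by rewrite mxE.
have oppE (A : 'M[R]_1) : (- A) 0 0 = - A 0 0 by rewrite mxE.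
have scaleE c (A : 'M[R]_1) : (c *: A) 0 0 = c * A 0 0 by rewrite mxE.
have scalarE c : (c%:M : 'M[R]_1) 0 0 = c by rewrite mxE eqxx mulr1n.
rewrite !(addE, oppE, scaleE, scalarE, mulmx11E) wb.
move: ((b^T *m w) 0 0) ((w^T *m D *m w) 0 0) => u v.
field.
exact: a0.
Qed.

(** One step of block Gaussian elimination: a unit lower triangular factor times a block upper
    triangular one. *)
Lemma det_block_schur k (a : R) (b : 'cV[R]_k) (D : 'M[R]_k) : a != 0 ->
  \det (block_mx a%:M b^T b D) = a * \det (schur a b D).
Proof.
move=> a0.
have -> : block_mx a%:M b^T b D =
    block_mx 1%:M 0 (a^-1 *: b) 1%:M *m block_mx a%:M b^T 0 (schur a b D).
  rewrite mulmx_block !mul1mx !mul0mx !addr0 mul_mx_scalar scalerA.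
  by rewrite divff// scale1r -scalemxAl /schur addrC subrK.
by rewrite det_mulmx det_lblock det_ublock !det1 !mul1r det_scalar1.
Qed.

(** The corner is positive by testing the form on the first basis vector. For the Schur complement,
    [w] is extended by the first coordinate at which the square in [form_block] vanishes. *)
Lemma posdef_block k (M : 'M[R]_(1 + k)) : posdef M ->
  exists a b D, [/\ 0 < a, M = block_mx a%:M b^T b D & posdef (schur a b D)].
Proof.
move=> [MT Mpos].
pose a := ulsubmx M 0 0; pose b := dlsubmx M; pose D := drsubmx M.
have ME : M = block_mx a%:M b^T b D.
  rewrite -[LHS]submxK; congr block_mx.
    by apply/matrixP => i j; rewrite !ord1 /a [RHS]mxE eqxx mulr1n.
  by rewrite /b trmx_dlsub MT.
have DT : D^T = D by rewrite /D trmx_drsub MT.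
have a_gt0 : 0 < a.
  have e0 : delta_mx 0 0 != 0 :> 'cV[R]_(1 + k).
    by apply/eqP => /matrixP/(_ 0 0)/eqP; rewrite !mxE !eqxx oner_eq0.
  have := Mpos _ e0; rewrite trmx_delta -rowE -colE /a !mxE.
  by rewrite (_ : lshift k 0 = 0)//; exact: val_inj.
exists a, b, D; split=> //; split.
  by rewrite /schur linearB/= linearZ/= trmx_mul trmxK DT.
move=> w w0.
pose t := - (a^-1 * (b^T *m w) 0 0).
have tw0 : cons_cv (t, w) != 0.
  apply: contra w0 => /eqP/(congr1 dsubmx); rewrite col_mxKd /= => ->.
  by apply/eqP/matrixP => i j; rewrite !mxE.
have := Mpos _ tw0; rewrite ME form_block ?gt_eqF//.
by rewrite /t addNr expr0n mulr0 add0r.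
Qed.

Lemma posdef_det_gt0 k (M : 'M[R]_k) : posdef M -> 0 < \det M.
Proof.
elim: k => [|k IH] in M *; first by rewrite det_mx00.
move=> /(@posdef_block k)[a [b [D [a0 -> S]]]].
by rewrite det_block_schur ?gt_eqF// mulr_gt0// IH.
Qed.

(** The integrand is the unnormalised normal density with mean [- c] and standard deviation [s], and
    its mass is the inverse of [normal_peak s]. *)
Lemma integral_gauss1 (a c : R) : 0 < a ->
  (\int[mu]_t (expR (- (a * (t + c) ^+ 2) / 2))%:E =
   (Num.sqrt (2 * pi / a))%:E)%E.
Proof.
move=> a0.
pose s := (Num.sqrt a)^-1.
have s0 : s != 0 by rewrite invr_eq0 sqrtr_eq0 -ltNge.
have s2 : s ^+ 2 = a^-1 by rewrite exprVn sqr_sqrtr// ltW.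
have nfE t : normal_fun (- c) s t = expR (- (a * (t + c) ^+ 2) / 2).
  by rewrite /normal_fun s2 opprK; congr expR; field; exact: lt0r_neq0.
have pE : normal_peak s = (Num.sqrt (2 * pi / a))^-1.
  by rewrite /normal_peak s2; congr (Num.sqrt _)^-1; field; exact: lt0r_neq0.
have q0 : 0 < Num.sqrt (2 * pi / a).
  by rewrite sqrtr_gt0 divr_gt0// mulr_gt0// pi_gt0.
have mf : measurable_fun setT (fun t => (normal_fun (- c) s t)%:E).
  by apply/measurable_EFinP; exact: measurable_normal_fun.
have := integral_normal_pdf (- c) s.
rewrite normal_pdfE//; under eq_integral do rewrite EFinM.
rewrite ge0_integralZl//; last 2 first.
- by move=> t _; rewrite lee_fin normal_fun_ge0.
- by rewrite lee_fin normal_peak_ge0.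
rewrite pE => H.
under eq_integral do rewrite -nfE.
rewrite -[LHS]mul1e -(_ : (Num.sqrt (2 * pi / a))%:E *
  ((Num.sqrt (2 * pi / a))^-1)%:E = 1)%E.
  by rewrite -muleA H mule1.
by rewrite -EFinM divff// gt_eqF.
Qed.

(** For fixed [w], the integral over the first coordinate is a shifted one-dimensional Gaussian
    whose value does not depend on the shift, hence not on [w]. What is left is the Gaussian of the
    Schur complement, to which the induction applies. *)
Lemma integral_gauss_form k (M : 'M[R]_k) : posdef M ->
  (\int[muv k]_x (expR (- (x^T *m M *m x) 0 0 / 2))%:E =
   (Num.sqrt ((2 * pi) ^+ k / \det M))%:E)%E.
Proof.
elim: k => [|k IH] in M *.
  (* In dimension 0 the measure is a Dirac mass, so the integral is the value at the origin. *)
  move=> _; rewrite [LHS](@integral_dirac _ 'cV[R]_0 (0 : 'cV[R]_0) R setT)//; last first.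
    apply/measurable_EFinP; apply: measurableT_comp => //.
    apply: measurable_funM => //; apply: measurableT_comp => //.
    exact: measurable_fun_form.
  rewrite diracT mul1e det_mx00 expr0 divr1 sqrtr1.
  by rewrite mulmx0 mxE oppr0 mul0r expR0.
move=> /(@posdef_block k)[a [b [D [a0 ME S]]]].
rewrite {}ME det_block_schur ?gt_eqF//.
have mf : measurable_fun setT (fun x : 'cV[R]_(1 + k) =>
    (expR (- (x^T *m block_mx a%:M b^T b D *m x) 0 0 / 2))%:E).
  apply/measurable_EFinP; apply: measurableT_comp => //.
  apply: measurable_funM => //; apply: measurableT_comp => //.
  exact: measurable_fun_form.
apply: etrans (ge0_integral_lebesgue_vecS2 mf _) _ => [x|].
  by rewrite lee_fin expR_ge0.
transitivity (\int[muv k]_w ((Num.sqrt (2 * pi / a))%:E *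
    (expR (- (w^T *m schur a b D *m w) 0 0 / 2))%:E))%E.
  apply: eq_integral => w _.
  under eq_integral => t _.
    rewrite form_block ?gt_eqF// opprD mulrDl expRD EFinM muleC.
    over.
  rewrite ge0_integralZl//; last first.
    apply/measurable_EFinP; apply: measurableT_comp => //.
    apply: measurable_funM => //; apply: measurableT_comp => //.
    apply: measurable_funM => //; apply: measurable_funX.
    exact: measurable_funD.
  by rewrite integral_gauss1// muleC.
rewrite ge0_integralZl//; last first.
  apply/measurable_EFinP; apply: measurableT_comp => //.
  apply: measurable_funM => //; apply: measurableT_comp => //.
  exact: measurable_fun_form.
rewrite IH// -EFinM -sqrtrM; last first.
  by rewrite divr_ge0// ?mulr_ge0 ?pi_ge0// ltW.
by rewrite mulf_div exprS.
Qed.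

End gaussian_integral.

(** * Uniqueness of continuous densities *)

Section continuous_density.
Context (R : realType).
Local Notation mu := (@lebesgue_measure R).
Local Notation muv := (lebesgue_vec R).

(** A measurable subset is asked for because [A] will be a neighbourhood, which comes from the
    topology and carries no proof of measurability. *)
Definition charges d (T : measurableType d) (m : set T -> \bar R) (A : set T) :=
  exists B, [/\ measurable B, B `<=` A & (0 < m B)%E].

(** On a measurable [B] where [f] exceeds [g] by [e], integrating both densities gives
    [law B + e * m B <= law B], impossible when [law B] is finite and [m B] positive. *)
Lemma pdf_not_charges d (T : measurableType d) (m : {measure set T -> \bar R})
    (law : set T -> \bar R) (f g : T -> R) (e : R) : (law setT < +oo)%E ->
  is_pdf m law f -> is_pdf m law g -> 0 < e ->
  ~ charges m [set x | g x + e <= f x].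
Proof.
move=> lawfin [mf f0 lawf] [mg g0 lawg] e0 [B [mB Bfg mB0]].
have mfE D : measurable_fun D (EFin \o f).
  by apply/measurable_EFinP; exact: measurable_funTS.
have mgE D : measurable_fun D (EFin \o g).
  by apply/measurable_EFinP; exact: measurable_funTS.
have lawB : law B \is a fin_num.
  rewrite ge0_fin_numE; last by rewrite lawf//; apply: integral_ge0 => x _; rewrite lee_fin.
  apply: le_lt_trans lawfin; rewrite !lawf//.
  by apply: ge0_subset_integral => // x _; rewrite lee_fin.
have : (law B + e%:E * m B <= law B)%E.
  rewrite {1}lawg// lawf// -integral_cst// -ge0_integralD//; first last.
  - by move=> x _; rewrite lee_fin ltW.
  - by move=> x _; rewrite lee_fin.
  apply: ge0_le_integral => //.
  - by move=> x _; rewrite adde_ge0// lee_fin// ltW.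
  - by apply: emeasurable_funD.
rewrite -[leRHS]adde0 leeD2lE// leNgt => /negP; apply.
exact: mule_gt0.
Qed.

(** An open cube: for positive [e] it lies in a ball of the matrix topology, and it splits as a
    product along [cons_cv], hence is measurable with computable measure. *)
Definition box k (x : 'cV[R]_k) (e : R) : set 'cV[R]_k :=
  [set y | forall i, `|x i 0 - y i 0| < e].

Lemma box_cons k (x : 'cV[R]_(1 + k)) (e : R) (t : R) (w : 'cV[R]_k) :
  box x e (cons_cv (t, w)) <->
  ball (usubmx x 0 0) e t /\ box (dsubmx x) e w.
Proof.
rewrite /box /cons_cv /=; split=> [H|[H1 H2] i].
  split=> [|i].
    by have := H (lshift k 0); rewrite col_mxEu !mxE.
  by have := H (rshift 1 i); rewrite col_mxEd !mxE.
case: (split_ordP i) => j ->.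
  by rewrite !ord1 col_mxEu; move: H1; rewrite !mxE.
by rewrite col_mxEd; move: (H2 j); rewrite !mxE.
Qed.

Lemma measurable_box k (x : 'cV[R]_k) (e : R) : measurable (box x e).
Proof.
elim: k => [|k IH] in x *.
  by rewrite (_ : box x e = setT)//; apply/seteqP; split => // y _ [].
suff H (z : 'cV[R]_(1 + k)) : measurable (box z e) by exact: H.
rewrite (_ : box z e = (fun v : 'cV[R]_(1 + k) =>
    (usubmx v 0 0, dsubmx v) : R * 'cV[R]_k) @^-1`
    (ball (usubmx z 0 0) e `*` box (dsubmx z) e)).
  rewrite -[X in measurable X]setTI; apply: (@measurable_cv_uncons R k) => //.
  by apply: measurableX => //; exact: measurable_ball.
have consE v : v = cons_cv (usubmx v 0 0, dsubmx v) :> 'cV[R]_(1 + k).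
  rewrite /cons_cv/= -[LHS]vsubmxK; congr col_mx.
  by apply/matrixP => i j; rewrite !ord1 [RHS]mxE.
by apply/seteqP; split => v /=; rewrite [in box z e v](consE v) box_cons.
Qed.

Lemma lebesgue_vec_box_gt0 k (x : 'cV[R]_k) (e : R) : 0 < e ->
  (0 < muv k (box x e))%E.
Proof.
move=> e0; elim: k => [|k IH] in x *.
  rewrite (_ : box x e = setT); last by apply/seteqP; split => // y _ [].
  by change (0 < @dirac _ 'cV[R]_0 (0%R : 'cV[R]_0) R setT)%E; rewrite diracT.
suff H (z : 'cV[R]_(1 + k)) : (0 < muv (1 + k) (box z e))%E by exact: H.
have boxE : @cons_cv R k @^-1` box z e =
    ball (usubmx z 0 0) e `*` box (dsubmx z) e.
  by apply/seteqP; split => -[t w] /=; rewrite box_cons.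
change (0 < (mu \x muv k) (@cons_cv R k @^-1` box z e))%E.
rewrite boxE product_measure1E; [|exact: measurable_ball|exact: measurable_box].
rewrite mule_gt0//= lebesgue_measure_ball ?ltW//.
by rewrite lte_fin pmulrn_lgt0.
Qed.

Lemma nbhs_charges k (x : 'cV[R]_k) (A : set 'cV[R]_k) :
  nbhs x A -> charges (muv k) A.
Proof.
move=> /nbhs_ballP[e /= e0 xA]; exists (box x e); split.
- exact: measurable_box.
- by move=> y xy; apply: xA; split=> // i j; rewrite !ord1; exact: xy.
- exact: lebesgue_vec_box_gt0.
Qed.

Lemma nbhs_prod_charges k l (z : 'cV[R]_k * 'cV[R]_l) A :
  nbhs z A -> charges (muv k \x muv l)%E A.
Proof.
move=> [[A1 A2] /= [/nbhs_charges[B1 [mB1 BA1 B1_gt0]]]].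
move=> /nbhs_charges[B2 [mB2 BA2 B2_gt0]] AA; exists (B1 `*` B2); split.
- exact: measurableX.
- by move=> -[a b] [/= Ba Bb]; apply: AA; split; [exact: BA1|exact: BA2].
- by rewrite product_measure1E// mule_gt0.
Qed.

(* [S] and [T] are the same set carrying its topology and its sigma-algebra. *)
Lemma continuous_pdf_unique (S : topologicalType) d (T : measurableType d)
    (i : S -> T) (m : {measure set T -> \bar R}) (law : set T -> \bar R)
    (f g : T -> R) :
  (forall (x : S) (A : set T), nbhs x (i @^-1` A) -> charges m A) ->
  (law setT < +oo)%E ->
  continuous (f \o i) -> is_pdf m law f -> continuous (g \o i) -> is_pdf m law g ->
  f \o i = g \o i.
Proof.
move=> ch lawfin cf pf cg pg; apply/funext => x.
wlog fg : f g cf pf cg pg / g (i x) < f (i x).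
  move=> H; have [fg|fg|//] := ltgtP (f (i x)) (g (i x)).
    by apply/esym; exact: H.
  exact: H.
(* With [e] half the gap at [x], continuity keeps the gap above [e] on a neighbourhood, and
   neighbourhoods are charged. *)
exfalso; pose e := (f (i x) - g (i x)) / 2.
have e0 : 0 < e by rewrite divr_gt0// subr_gt0.
apply: (pdf_not_charges lawfin pf pg e0); apply: (ch x).
have cfg : {for x, continuous (fun s => f (i s) - g (i s))}.
  by apply: cvgB; [exact: cf|exact: cg].
have : \forall s \near x, e < f (i s) - g (i s).
  by apply: (cvgr_gt _ cfg); rewrite /e ltr_pdivrMr// ltr_pMr ?subr_gt0// ltr1n.
by apply: filterS => s /=; rewrite ltrBrDl => /ltW.
Qed.

(** [xget] selects some continuous density; uniqueness forces it to be the exhibited one. *)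
Lemma densityE k (law : set 'cV[R]_k -> \bar R) (f : 'cV[R]_k -> R) :
  (law setT < +oo)%E -> continuous f -> is_pdf (muv k) law f -> density law = f.
Proof.
move=> lawfin cf pf; apply: xget_unique; first by split.
move=> g [cg pg].
exact: (@continuous_pdf_unique 'cV[R]_k _ 'cV[R]_k idfun (muv k) law g f
  (@nbhs_charges k) lawfin cg pg cf pf).
Qed.

Lemma joint_densityE k l (law : set ('cV[R]_k * 'cV[R]_l) -> \bar R)
    (f : 'cV[R]_k * 'cV[R]_l -> R) :
  (law setT < +oo)%E -> continuous f -> is_pdf (muv k \x muv l)%E law f ->
  joint_density law = f.
Proof.
move=> lawfin cf pf; apply: xget_unique; first by split.
move=> g [cg pg].
exact: (@continuous_pdf_unique ('cV[R]_k * 'cV[R]_l)%type _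
  ('cV[R]_k * 'cV[R]_l)%type idfun (muv k \x muv l)%E law g f
  (@nbhs_prod_charges k l) lawfin cg pg cf pf).
Qed.

End continuous_density.

(** * Joint and marginal laws *)

Section density_measure.
Context d (T : measurableType d) (R : realType).

Lemma integral_indicM (m : {measure set T -> \bar R}) (f : T -> R) (A : set T) :
  (\int[m]_(x in A) (f x)%:E = \int[m]_x (f x * \1_A x)%:E)%E.
Proof.
rewrite integral_mkcond; apply: eq_integral => x _.
by rewrite patchE indicE; case: (x \in A); rewrite ?mulr1 ?mulr0.
Qed.

(** The two hypotheses are arguments so that a measure structure can be attached to the term. *)
Definition density_measure (m : {measure set T -> \bar R}) (f : T -> R)
    (_ : measurable_fun setT f) (_ : forall x, 0 <= f x) : set T -> \bar R :=
  fun A => (\int[m]_(x in A) (f x)%:E)%E.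

Variables (m : {measure set T -> \bar R}) (f : T -> R).
Hypotheses (mf : measurable_fun setT f) (f0 : forall x, 0 <= f x).

Let density_measure0 : density_measure m mf f0 set0 = 0%E.
Proof. exact: integral_set0. Qed.

Let density_measure_ge0 A : (0 <= density_measure m mf f0 A)%E.
Proof. by apply: integral_ge0 => x _; rewrite lee_fin. Qed.

Let density_measure_sigma_additive : semi_sigma_additive (density_measure m mf f0).
Proof.
move=> F mF tF mUF; rewrite /density_measure ge0_integral_bigcup//.
- apply: is_cvg_ereal_nneg_natsum_cond => n _ _.
  by apply: integral_ge0 => x _; rewrite lee_fin.
- by apply/measurable_EFinP; exact: measurable_funTS.
- by move=> x _; rewrite lee_fin.
Qed.

HB.instance Definition _ := isMeasure.Build _ _ _ (density_measure m mf f0)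
  density_measure0 density_measure_ge0 density_measure_sigma_additive.

End density_measure.

Section laws.
Context d d1 d2 (T : measurableType d) (T1 : measurableType d1)
  (T2 : measurableType d2) (R : realType) (P : probability T R).
Variables (m1 : {sigma_finite_measure set T1 -> \bar R})
  (m2 : {sigma_finite_measure set T2 -> \bar R}).

Lemma ge0_integral_setX (f : T1 -> R) (g : T2 -> R) (A : set T1) (B : set T2) :
  measurable_fun setT f -> (forall x, 0 <= f x) ->
  measurable_fun setT g -> (forall x, 0 <= g x) -> measurable A -> measurable B ->
  (\int[m1 \x m2]_(z in A `*` B) (f z.1 * g z.2)%:E =
   \int[m1]_(x in A) (f x)%:E * \int[m2]_(y in B) (g y)%:E)%E.
Proof.
move=> mf f0 mg g0 mA mB.
have mfg : measurable_fun setT (fun z : T1 * T2 => f z.1 * g z.2).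
  by apply: measurable_funM; exact: measurableT_comp.
rewrite [LHS](@integral_indicM _ _ _ (m1 \x m2)%E (fun z => f z.1 * g z.2)).
rewrite (integral_indicM m1 f) (integral_indicM m2 g).
have mfA : measurable_fun setT (fun x => (f x * \1_A x)%:E).
  by apply/measurable_EFinP; apply: measurable_funM.
have mgB : measurable_fun setT (fun x => (g x * \1_B x)%:E).
  by apply/measurable_EFinP; apply: measurable_funM.
have fA0 x : (0 <= (f x * \1_A x)%:E)%E by rewrite lee_fin mulr_ge0.
have gB0 x : (0 <= (g x * \1_B x)%:E)%E by rewrite lee_fin mulr_ge0.
rewrite fubini_tonelli1/=; first last.
- by move=> z; rewrite lee_fin !mulr_ge0.
- apply/measurable_EFinP; apply: measurable_funM => //.
  by apply: measurable_indic; exact: measurableX.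
transitivity (\int[m1]_x ((f x * \1_A x)%:E * \int[m2]_y (g y * \1_B y)%:E))%E.
  apply: eq_integral => x _; rewrite -ge0_integralZl//.
  apply: eq_integral => y _; rewrite /fubini_F/= -EFinM; congr (_%:E).
  by rewrite !indicE in_setX /= -mulnb natrM; ring.
by rewrite ge0_integralZr//; exact: integral_ge0.
Qed.

(** The joint law and the measure with density the product of [f] and [g] both give a rectangle the
    product of its marginal masses, so both are the product measure. *)
Lemma independent_pdf (V : {RV P >-> T1}) (W : {RV P >-> T2})
    (f : T1 -> R) (g : T2 -> R) :
  independent V W -> is_pdf m1 (distribution P V) f ->
  is_pdf m2 (distribution P W) g ->
  is_pdf (m1 \x m2)%E (pushforward P (fun w => (V w, W w)))
    (fun z => f z.1 * g z.2).
Proof.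
move=> indep [mf f0 lawf] [mg g0 lawg].
have mfg : measurable_fun setT (fun z : T1 * T2 => f z.1 * g z.2).
  by apply: measurable_funM; exact: measurableT_comp.
have fg0 (z : T1 * T2) : 0 <= f z.1 * g z.2 by rewrite mulr_ge0.
have mVW : measurable_fun setT (fun w => (V w, W w)).
  exact: measurable_fun_pair.
split=> // C mC.
pose law := pushforward P (fun w => (V w, W w)).
pose fg := density_measure (m1 \x m2)%E mfg fg0.
transitivity ((distribution P V \x distribution P W)%E C).
  apply/esym.
  apply: (@product_measure_unique _ _ _ _ _ (distribution P V) (distribution P W) law) => //.
apply: (@product_measure_unique _ _ _ _ _ (distribution P V) (distribution P W) fg) => //.
move=> A B mA mB.
apply: etrans _ (esym (f_equal2 mule (lawf _ mA) (lawg _ mB))).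
exact: ge0_integral_setX.
Qed.

(** Tonelli on [setT] times [A]. Measurability and positivity of [g] are inherited from the partial
    integrals of [h]. *)
Lemma marginal_pdf (V : {RV P >-> T1}) (W : {RV P >-> T2})
    (h : T1 * T2 -> R) (g : T2 -> R) :
  is_pdf (m1 \x m2)%E (pushforward P (fun w => (V w, W w))) h ->
  (forall y, \int[m1]_x (h (x, y))%:E = (g y)%:E)%E ->
  is_pdf m2 (distribution P W) g.
Proof.
move=> [mh h0 lawh] hg.
have mhE : measurable_fun setT (EFin \o h) by exact/measurable_EFinP.
have mg : measurable_fun setT g.
  apply/measurable_EFinP.
  have := @measurable_fun_fubini_tonelli_G _ _ _ _ _ m1 (EFin \o h) mhE.
  rewrite (_ : fubini_G _ _ = EFin \o g); last exact/funext.
  by apply => z; rewrite lee_fin.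
split=> // [y|A mA].
  by rewrite -lee_fin -hg; apply: integral_ge0 => x _; rewrite lee_fin.
have -> : distribution P W A = pushforward P (fun w => (V w, W w)) (setT `*` A).
  by rewrite /distribution /pushforward; congr (P _); apply/seteqP; split => // w [].
rewrite lawh; last exact: measurableX.
rewrite (integral_indicM (m1 \x m2)%E h) (integral_indicM m2 g).
rewrite fubini_tonelli2/=; first last.
- by move=> z; rewrite lee_fin !mulr_ge0.
- apply/measurable_EFinP; apply: measurable_funM => //.
  by apply: measurable_indic; exact: measurableX.
apply: eq_integral => y _; rewrite EFinM -hg -ge0_integralZr//; last 2 first.
- exact: (measurable_fun_pair1 y mhE).
- by move=> x _; rewrite lee_fin.
by apply: eq_integral => x _; rewrite /fubini_G/= !indicE in_setX in_setT.
Qed.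

End laws.

(** [(V, Y)] is the image of [(V, eps)] under the shear [Phi], which preserves the product measure
    because it is a translation of the second component once the first is fixed. *)
Lemma regression_pdf d d1 (T : measurableType d) (T1 : measurableType d1)
    (R : realType) (P : probability T R) k
    (m1 : {sigma_finite_measure set T1 -> \bar R})
    (V : {RV P >-> T1}) (eps Y : {RV P >-> 'cV[R]_k})
    (phi : T1 -> 'cV[R]_k) (f : T1 -> R) (g : 'cV[R]_k -> R) :
  measurable_fun setT phi -> (forall w, Y w = phi (V w) + eps w) ->
  independent V eps -> is_pdf m1 (distribution P V) f ->
  is_pdf (lebesgue_vec R k) (distribution P eps) g ->
  is_pdf (m1 \x lebesgue_vec R k)%E (pushforward P (fun w => (V w, Y w)))
    (fun z => f z.1 * g (z.2 - phi z.1)).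
Proof.
move=> mphi YE indep pf pg.
have [mh h0 lawh] := independent_pdf indep pf pg.
have [mf f0 _] := pf; have [mg g0 _] := pg.
have mres : measurable_fun setT (fun z : T1 * 'cV[R]_k => z.2 - phi z.1).
  apply: measurable_fun_mxD => //; apply: measurable_fun_mxN.
  exact: measurableT_comp.
have mfg : measurable_fun setT
    (fun z : T1 * 'cV[R]_k => f z.1 * g (z.2 - phi z.1)).
  apply: measurable_funM; first exact: measurableT_comp.
  exact: (measurableT_comp mg mres).
split=> // [z|C mC]; first by rewrite mulr_ge0.
pose Phi (z : T1 * 'cV[R]_k) := (z.1, phi z.1 + z.2).
have mPhi : measurable_fun setT Phi.
  apply: measurable_fun_pair => //; apply: measurable_fun_mxD => //.
  exact: measurableT_comp.
have mPhiC : measurable (Phi @^-1` C).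
  by rewrite -[X in measurable X]setTI; exact: mPhi.
have -> : pushforward P (fun w => (V w, Y w)) C =
    pushforward P (fun w => (V w, eps w)) (Phi @^-1` C).
  by rewrite /pushforward; congr (P _); apply/seteqP; split => w /=;
    rewrite /Phi/= YE.
rewrite lawh// (integral_indicM _ (fun z => f z.1 * g z.2)).
rewrite (integral_indicM _ (fun z : T1 * 'cV[R]_k => f z.1 * g (z.2 - phi z.1))).
rewrite !fubini_tonelli1/=; first last.
- by move=> z; rewrite lee_fin !mulr_ge0.
- by apply/measurable_EFinP; apply: measurable_funM => //; exact: measurable_indic.
- by move=> z; rewrite lee_fin !mulr_ge0.
- by apply/measurable_EFinP; apply: measurable_funM => //; exact: measurable_indic.
apply: eq_integral => x _; rewrite /fubini_F/=.
(* Translating by [phi x] turns the residual back into the noise variable. *)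
rewrite -[RHS](@ge0_integral_lebesgue_vec_affine R k 1 (phi x)); first last.
- by move=> y; rewrite lee_fin !mulr_ge0.
- apply: (measurable_fun_pair2 (f := fun z : T1 * 'cV[R]_k =>
    (f z.1 * g (z.2 - phi z.1) * \1_C z)%:E)).
  by apply/measurable_EFinP; apply: measurable_funM => //; exact: measurable_indic.
- by rewrite mulr1.
apply: eq_integral => y _; rewrite scale1r addrK !indicE.
by congr (_ * (_ \in C)%:R)%:E; rewrite /Phi/= addrC.
Qed.

(** * Mass and first moments of Gaussian densities *)

Section gaussian_moments.
Context (R : realType).
Local Notation muv := (lebesgue_vec R).

Definition form k (M : 'M[R]_k) (x : 'cV[R]_k) : R := (x^T *m M *m x) 0 0.

Lemma formZ k (c : R) (M : 'M[R]_k) x : form (c *: M) x = c * form M x.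
Proof. by rewrite /form -scalemxAr -scalemxAl mxE. Qed.

Lemma formN k (M : 'M[R]_k) x : form M (- x) = form M x.
Proof. rewrite /form.
have -> : (- x)^T = - x^T by apply/matrixP => i j; rewrite !mxE.
by rewrite !mulNmx mulmxN opprK. Qed.

Lemma posdefZ k (c : R) (M : 'M[R]_k) : 0 < c -> posdef M -> posdef (c *: M).
Proof.
move=> c0 [MT Mpos]; split=> [|x x0]; first by rewrite linearZ/= MT.
by have := formZ c M x; rewrite /form => ->; rewrite mulr_gt0// Mpos.
Qed.

Lemma posdef_form_ge0 k (M : 'M[R]_k) x : posdef M -> 0 <= form M x.
Proof.
move=> [_ Mpos]; have [->|x0] := eqVneq x 0; first by rewrite /form mulmx0 mxE.
exact/ltW/Mpos.
Qed.

(** For positive definite [M], the unnormalised centred normal density, with [M] the inverse of the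
    covariance. *)
Definition gauss k (M : 'M[R]_k) (x : 'cV[R]_k) : R := expR (- form M x / 2).

Definition gauss_mass k (M : 'M[R]_k) : R := Num.sqrt ((2 * pi) ^+ k / \det M).

Lemma gauss_ge0 k (M : 'M[R]_k) x : 0 <= gauss M x.
Proof. exact: expR_ge0. Qed.

Lemma measurable_gauss k (M : 'M[R]_k) : measurable_fun setT (gauss M).
Proof.
apply: measurableT_comp => //; apply: measurable_funM => //.
by apply: measurableT_comp => //; exact: measurable_fun_form.
Qed.

Lemma integral_gauss k (M : 'M[R]_k) : posdef M ->
  (\int[muv k]_x (gauss M x)%:E = (gauss_mass M)%:E)%E.
Proof. exact: integral_gauss_form. Qed.

Lemma integral_gauss_shift k (M : 'M[R]_k) (c : 'cV[R]_k) : posdef M ->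
  (\int[muv k]_x (gauss M (x - c))%:E = (gauss_mass M)%:E)%E.
Proof.
move=> pM; rewrite -(integral_gauss pM).
rewrite -(@ge0_integral_lebesgue_vec_affine R k 1 (- c) (fun x => (gauss M x)%:E)).
- by apply: eq_integral => x _; rewrite scale1r.
- by rewrite mulr1.
- by apply/measurable_EFinP; exact: measurable_gauss.
- by move=> x /=; rewrite lee_fin; exact: gauss_ge0.
Qed.

Lemma integrable_gauss k (M : 'M[R]_k) : posdef M ->
  (muv k).-integrable setT (fun x => (gauss M x)%:E).
Proof.
move=> pM; apply/integrableP; split; first by apply/measurable_EFinP; exact: measurable_gauss.
under eq_integral do rewrite gee0_abs ?lee_fin ?gauss_ge0//.
by rewrite integral_gauss// ltry.
Qed.

Lemma measurable_coord_gauss k (M : 'M[R]_k) i :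
  measurable_fun setT (fun x : 'cV[R]_k => (x i 0 * gauss M x)%:E).
Proof.
apply/measurable_EFinP; apply: measurable_funM; first exact: measurable_mx_entry.
exact: measurable_gauss.
Qed.

(** The bound with [C] plays the part of a lower bound on the spectrum of [M]; it lets the linear
    factor be absorbed by a wider Gaussian. *)
Lemma integrable_coord_gauss k (M : 'M[R]_k) (C : R) i : posdef M -> 0 <= C ->
  (forall x : 'cV[R]_k, x i 0 ^+ 2 <= C * form M x) ->
  (muv k).-integrable setT (fun x : 'cV[R]_k => (x i 0 * gauss M x)%:E).
Proof.
move=> pM C0 MC.
have half : posdef (2^-1 *: M) by apply: posdefZ => //; rewrite invr_gt0.
(* The constant comes from [1 + C * t <= (1 + 4 * C) * (1 + t / 4)] with [t = form M x], followed by
   [1 + t / 4 <= expR (t / 4)]. *)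
apply: (@le_integrable _ _ _ _ _ _ _
    (fun x => (1 + 4 * C)%:E * (gauss (2^-1 *: M) x)%:E)%E) => //.
- exact: measurable_coord_gauss.
- move=> x _ /=; rewrite lee_fin normrM (ger0_norm (gauss_ge0 _ _)).
  rewrite [leRHS]ger0_norm; last by rewrite mulr_ge0 ?gauss_ge0// addr_ge0// mulr_ge0.
  (* [`|u| <= 1 + u ^+ 2] costs half of the exponent. *)
  have := MC x; have := posdef_form_ge0 x pM.
  rewrite /gauss formZ; move: (form M x) (x i 0) => t u t0 ut.
  rewrite (_ : - t / 2 = - (2^-1 * t) / 2 + - (t / 4)); last by field.
  rewrite expRD mulrCA mulrC ler_wpM2r ?expR_ge0//.
  rewrite expRN ler_pdivrMr ?expR_gt0//.
  have et : 1 + t / 4 <= expR (t / 4) by apply: expR_ge1Dx.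
  have : `|u| <= 1 + u ^+ 2.
    by rewrite -real_normK ?num_real//; have := sqr_ge0 (`|u| - 1); have := normr_ge0 u; nra.
  nra.
- exact/integrableZl/integrable_gauss.
Qed.

(** The integrand is odd: reflection equates the integral with its opposite, and it is finite. *)
Lemma integral_coord_gauss k (M : 'M[R]_k) (C : R) i : posdef M -> 0 <= C ->
  (forall x : 'cV[R]_k, x i 0 ^+ 2 <= C * form M x) ->
  (\int[muv k]_x (x i 0 * gauss M x)%:E = 0)%E.
Proof.
move=> pM C0 MC; have iM := integrable_coord_gauss pM C0 MC.
have : (\int[muv k]_x (x i 0 * gauss M x)%:E \is a fin_num)%E.
  exact: integrable_fin_num.
have : (\int[muv k]_x (x i 0 * gauss M x)%:E =
    - \int[muv k]_x (x i 0 * gauss M x)%:E)%E.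
  rewrite -integralN; last exact: integrable_add_def.
  rewrite -(@integral_lebesgue_vec_affine R k (-1) 0 (fun x => (x i 0 * gauss M x)%:E)).
  - apply: eq_integral => x _; rewrite scaleN1r addr0 /gauss formN mxE.
    by rewrite mulNr.
  - by rewrite mulrNN mulr1.
  - exact: measurable_coord_gauss.
case: integral => //= r [] rr _; congr EFin; lra.
Qed.

(** After recentring at [c], the coordinate is an odd part, which integrates to zero, plus the
    constant [c i 0]. *)
Lemma integral_coord_gauss_shift k (M : 'M[R]_k) (c : 'cV[R]_k) (K C : R) i :
  posdef M -> 0 <= C -> (forall x : 'cV[R]_k, x i 0 ^+ 2 <= C * form M x) ->
  (\int[muv k]_x (x i 0 * (K * gauss M (x - c)))%:E =
   (K * c i 0 * gauss_mass M)%:E)%E.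
Proof.
move=> pM C0 MC; have iM := integrable_coord_gauss pM C0 MC.
rewrite -(@integral_lebesgue_vec_affine R k 1 c
  (fun x => (x i 0 * (K * gauss M (x - c)))%:E)); first last.
- apply/measurable_EFinP; apply: measurable_funM; first exact: measurable_mx_entry.
  apply: measurable_funM => //; apply: (measurableT_comp (measurable_gauss M)).
  exact: measurable_fun_mxD.
- by rewrite mulr1.
transitivity (\int[muv k]_x (K%:E * (x i 0 * gauss M x)%:E +
    (K * c i 0)%:E * (gauss M x)%:E))%E.
  apply: eq_integral => x _; rewrite scale1r addrK mxE -!EFinM -EFinD.
  by congr EFin; ring.
rewrite integralD//; last 2 first.
- exact: integrableZl.
- exact/integrableZl/integrable_gauss.
rewrite integralZl// (integral_coord_gauss pM C0 MC) mule0 add0e.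
by rewrite integralZl ?integral_gauss//; exact: integrable_gauss.
Qed.

End gaussian_moments.

(** * The linear mixed model *)

Section penalized_least_squares.
Context (R : realType) (n q : nat) (A : 'M[R]_(n, q)).

Definition sqnorm k (v : 'cV[R]_k) : R := (v^T *m v) 0 0.

Lemma sqnormE k (v : 'cV[R]_k) : sqnorm v = \sum_i v i 0 ^+ 2.
Proof. by rewrite /sqnorm mxE; apply: eq_bigr => i _; rewrite mxE expr2. Qed.

Lemma sqnorm_ge0 k (v : 'cV[R]_k) : 0 <= sqnorm v.
Proof. by rewrite sqnormE sumr_ge0// => i _; exact: sqr_ge0. Qed.

Lemma sqr_coord_le_sqnorm k (v : 'cV[R]_k) i : v i 0 ^+ 2 <= sqnorm v.
Proof.
by rewrite sqnormE (bigD1 i)//= lerDl sumr_ge0// => j _; exact: sqr_ge0.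
Qed.

Lemma enorm_sqr k (v : 'cV[R]_k) : enorm v ^+ 2 = sqnorm v.
Proof.
by rewrite sqnormE sqr_sqrtr// sumr_ge0// => i _; exact: sqr_ge0.
Qed.

Lemma form_scalar k (c : R) (v : 'cV[R]_k) : form c%:M v = c * sqnorm v.
Proof. by rewrite /form mul_mx_scalar -scalemxAl mxE. Qed.

Definition gram : 'M[R]_q := A^T *m A + 1%:M.

Lemma form_gram v : form gram v = sqnorm (A *m v) + sqnorm v.
Proof.
by rewrite /form /gram mulmxDr mulmxDl mxE mulmx1 /sqnorm trmx_mul !mulmxA.
Qed.

(** The identity summand makes the form definite whatever the rank of [A]. *)
Lemma posdef_gram : posdef gram.
Proof.
split=> [|v v0].
  by rewrite /gram linearD/= trmx_mul trmxK trmx1.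
rewrite -/(form gram v) form_gram ltr_wpDl ?sqnorm_ge0//.
have [i vi] : exists i, v i 0 != 0.
  by apply/cV0Pn.
by apply: lt_le_trans (sqr_coord_le_sqnorm v i); rewrite exprn_even_gt0.
Qed.

(** The point at which the penalized criterion [sqnorm (r - A *m u) + sqnorm u] is minimal, as
    [complete_square] shows. *)
Definition ridge (r : 'cV[R]_n) : 'cV[R]_q := invmx gram *m (A^T *m r).

Definition penalized_rss (r : 'cV[R]_n) : R :=
  sqnorm (r - A *m ridge r) + sqnorm (ridge r).

Lemma penalized_rss_ge0 r : 0 <= penalized_rss r.
Proof. by rewrite addr_ge0 ?sqnorm_ge0. Qed.

(** A rearrangement of [gram *m ridge r = A^T *m r], in the form that cancels cross terms. *)
Lemma normal_equations r : A^T *m (r - A *m ridge r) = ridge r.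
Proof.
have gU : gram \in unitmx.
  by rewrite unitmxE unitfE gt_eqF// posdef_det_gt0//; exact: posdef_gram.
have ridgeE : gram *m ridge r = A^T *m r by rewrite /ridge mulKVmx.
by rewrite mulmxBr -ridgeE /gram mulmxDl mul1mx -mulmxA addrAC subrr add0r.
Qed.

Lemma sqnormD k (u v : 'cV[R]_k) :
  sqnorm (u + v) = sqnorm u + 2 * (u^T *m v) 0 0 + sqnorm v.
Proof.
have -> : (u^T *m v) 0 0 = \sum_i u i 0 * v i 0.
  by rewrite mxE; apply: eq_bigr => i _; rewrite mxE.
rewrite !sqnormE mulr_sumr -!big_split/=; apply: eq_bigr => i _.
by rewrite mxE; ring.
Qed.

(** Expanding both norms around [ridge r] yields two cross terms, which are opposite by the normal
    equations; the quadratic terms in [v] add up to the form of [gram]. *)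
Lemma complete_square r u :
  sqnorm (r - A *m u) + sqnorm u = penalized_rss r + form gram (u - ridge r).
Proof.
set v := u - ridge r; have -> : u = ridge r + v by rewrite /v addrC subrK.
rewrite form_gram mulmxDr opprD addrA (sqnormD (r - A *m ridge r)) (sqnormD (ridge r)).
have -> : ((r - A *m ridge r)^T *m - (A *m v)) 0 0 = - ((ridge r)^T *m v) 0 0.
  by rewrite mulmxN mxE mulmxA -[_ *m A]trmxK trmx_mul trmxK normal_equations.
have -> : sqnorm (- (A *m v)) = sqnorm (A *m v).
  by rewrite !sqnormE; apply: eq_bigr => i _; rewrite mxE sqrrN.
by rewrite /penalized_rss; ring.
Qed.

End penalized_least_squares.

(** * Joint, marginal and conditional densities in the model *)

Section model.
Context (R : realType) (n q : nat) (A : 'M[R]_(n, q)) (b : 'cV[R]_n) (s : R).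
Hypothesis s0 : 0 < s.
Local Notation muv := (lebesgue_vec R).

(** The inverse covariance of the random effects given the observation. *)
Definition precision : 'M[R]_q := s^-1 *: gram A.

Lemma posdef_precision : posdef precision.
Proof. by apply: posdefZ; [rewrite invr_gt0|exact: posdef_gram]. Qed.

Lemma gauss_mass_gt0 k (M : 'M[R]_k) : posdef M -> 0 < gauss_mass M.
Proof.
move=> pM; rewrite sqrtr_gt0 divr_gt0 ?posdef_det_gt0// exprn_gt0//.
by rewrite mulr_gt0// pi_gt0.
Qed.

Lemma posdef_scalar k (c : R) : 0 < c -> posdef (c%:M : 'M[R]_k).
Proof.
move=> c0; split=> [|x x0]; first exact: tr_scalar_mx.
rewrite -/(form _ x) form_scalar mulr_gt0//.
by have /cV0Pn[i xi] := x0; apply: lt_le_trans (sqr_coord_le_sqnorm x i);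
  rewrite exprn_even_gt0.
Qed.

Lemma mvnormal_pdf_gauss k (x : 'cV[R]_k) : mvnormal_pdf 0 s%:M x =
  (gauss_mass (s^-1%:M : 'M[R]_k))^-1 * gauss s^-1%:M x.
Proof.
rewrite /mvnormal_pdf subr0 invmx_scalar; congr (_^-1 * _).
by rewrite /gauss_mass !det_scalar exprVn invrK.
Qed.

Definition joint_const : R :=
  (gauss_mass (s^-1%:M : 'M[R]_q))^-1 * (gauss_mass (s^-1%:M : 'M[R]_n))^-1.

Lemma joint_const_gt0 : 0 < joint_const.
Proof.
by rewrite mulr_gt0// invr_gt0 gauss_mass_gt0//; apply: posdef_scalar;
  rewrite invr_gt0.
Qed.

(** The second factor is the noise density at the residual; [b] stands for the fixed effects. *)
Definition joint_pdf (z : 'cV[R]_q * 'cV[R]_n) : R :=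
  mvnormal_pdf 0 s%:M z.1 * mvnormal_pdf 0 s%:M (z.2 - (b + A *m z.1)).

Definition marginal_pdf_value (y : 'cV[R]_n) : R :=
  joint_const * gauss_mass precision * expR (- penalized_rss A (y - b) / (2 * s)).

(** By [complete_square] the exponent separates: [u] enters only through a Gaussian centred at the
    ridge solution, so integrating [u] out needs only its mass. *)
Lemma joint_pdfE u y : joint_pdf (u, y) =
  joint_const * expR (- penalized_rss A (y - b) / (2 * s)) *
  gauss precision (u - ridge A (y - b)).
Proof.
rewrite /joint_pdf !mvnormal_pdf_gauss /= mulrACA -/joint_const -!mulrA.
congr (_ * _); rewrite /gauss -!expRD !form_scalar /precision formZ opprD addrA.
congr (_ * expR _).
have -> : form (gram A) (u - ridge A (y - b)) =
    sqnorm (y - b - A *m u) + sqnorm u - penalized_rss A (y - b).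
  by rewrite complete_square addrAC subrr add0r.
by field; rewrite gt_eqF.
Qed.

Lemma integral_joint_pdf y :
  (\int[muv q]_u (joint_pdf (u, y))%:E = (marginal_pdf_value y)%:E)%E.
Proof.
under eq_integral do rewrite joint_pdfE EFinM.
rewrite ge0_integralZl//; first 1 last.
- apply/measurable_EFinP; apply: (measurableT_comp (measurable_gauss _)).
  exact: measurable_fun_mxD.
- by move=> u _; rewrite lee_fin gauss_ge0.
- by rewrite lee_fin mulr_ge0 ?expR_ge0// ltW// joint_const_gt0.
rewrite integral_gauss_shift; last exact: posdef_precision.
by rewrite -EFinM /marginal_pdf_value mulrAC.
Qed.

Lemma continuous_mvnormal_pdf_comp (S : topologicalType) k (f : S -> 'cV[R]_k) :
  (forall i j, continuous (fun x => f x i j)) ->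
  continuous (fun x => mvnormal_pdf 0 s%:M (f x)).
Proof.
move=> cf; under eq_fun do rewrite mvnormal_pdf_gauss.
move=> x; apply: cvgM; first exact: cvg_cst.
apply: (cvg_comp _ expR); last exact: continuous_expR.
apply: cvgM; last exact: cvg_cst.
by apply: cvgN; exact: continuous_form.
Qed.

Lemma continuous_joint_pdf : continuous joint_pdf.
Proof.
have c1 i j : continuous (fun z : 'cV[R]_q * 'cV[R]_n => z.1 i j).
  move=> z; apply: (@continuous_comp _ _ _ fst (fun u : 'cV[R]_q => u i j)).
    exact: cvg_fst.
  exact: coord_continuous.
have c2 i j : continuous (fun z : 'cV[R]_q * 'cV[R]_n => z.2 i j).
  move=> z; apply: (@continuous_comp _ _ _ snd (fun u : 'cV[R]_n => u i j)).
    exact: cvg_snd.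
  exact: coord_continuous.
move=> z; apply: cvgM; first exact: continuous_mvnormal_pdf_comp.
apply: (continuous_mvnormal_pdf_comp
  (f := fun z : 'cV[R]_q * 'cV[R]_n => z.2 - (b + A *m z.1))) => i j.
under eq_fun do rewrite mxE [X in _ + X]mxE [X in - X]mxE.
move=> {}z; apply: cvgB; first exact: c2.
apply: cvgD; first exact: cvg_cst.
by apply: continuous_mulmx_entry => // i' j' {}z; exact: cvg_cst.
Qed.

Lemma continuous_penalized_rss_comp (S : topologicalType) (f : S -> 'cV[R]_n) :
  (forall i j, continuous (fun x => f x i j)) ->
  continuous (fun x => penalized_rss A (f x)).
Proof.
move=> cf.
have csq k (g : S -> 'cV[R]_k) : (forall i j, continuous (fun x => g x i j)) ->
    continuous (fun x => sqnorm (g x)).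
  move=> cg; apply: continuous_mulmx_entry => // i j.
  by under eq_fun do rewrite mxE; exact: cg.
have cridge i j : continuous (fun x => ridge A (f x) i j).
  apply: continuous_mulmx_entry => i' j'; first by move=> x; exact: cvg_cst.
  by apply: continuous_mulmx_entry => // i'' j'' x; exact: cvg_cst.
move=> x; apply: cvgD; apply: csq => // i j.
under eq_fun do rewrite mxE [X in _ + X]mxE.
move=> {}x; apply: cvgB; first exact: cf.
apply: (continuous_mulmx_entry (f := fun=> A) (g := ridge A \o f)) => // i' j' {}x.
exact: cvg_cst.
Qed.

Lemma continuous_marginal_pdf : continuous marginal_pdf_value.
Proof.
have crss : continuous (fun y : 'cV[R]_n => penalized_rss A (y - b)).
  apply: continuous_penalized_rss_comp => i j; under eq_fun do rewrite mxE.
  move=> y; apply: (@cvgD _ _ _ (nbhs y)); first exact: coord_continuous.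
  exact: cvg_cst.
move=> y; apply: (@cvgM _ _ (nbhs y)); first exact: cvg_cst.
apply: (cvg_comp _ expR); last exact: continuous_expR.
apply: (@cvgM _ _ (nbhs y)); last exact: cvg_cst.
by apply: (@cvgN _ _ _ (nbhs y)); exact: crss.
Qed.

Context d (T : measurableType d) (P : probability T R)
  (U : {RV P >-> 'cV[R]_q}) (eps Y : {RV P >-> 'cV[R]_n}).
Hypotheses (YE : forall w, Y w = b + A *m U w + eps w)
  (nU : normally_distributed U 0 s%:M) (neps : normally_distributed eps 0 s%:M)
  (indep : independent U eps).

Lemma joint_law_pdf : is_pdf (muv q \x muv n)%E
  (pushforward P (fun w => (U w, Y w))) joint_pdf.
Proof.
apply: (regression_pdf (eps := eps) (phi := fun u => b + A *m u)) => //.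
by apply: measurable_fun_mxD => //; exact: measurable_fun_mxM.
Qed.

Lemma marginal_law_pdf : is_pdf (muv n) (distribution P Y) marginal_pdf_value.
Proof. exact: marginal_pdf joint_law_pdf integral_joint_pdf. Qed.

Lemma density_marginal : density (distribution P Y) = marginal_pdf_value.
Proof.
apply: densityE; [|exact: continuous_marginal_pdf|exact: marginal_law_pdf].
by rewrite probability_setT ltry.
Qed.

Lemma joint_density_joint :
  joint_density (pushforward P (fun w => (U w, Y w))) = joint_pdf.
Proof.
apply: joint_densityE; [|exact: continuous_joint_pdf|exact: joint_law_pdf].
by rewrite /pushforward preimage_setT probability_setT ltry.
Qed.

(** The factors of [joint_pdfE] free of [u] cancel against the marginal, leaving a normalised
    Gaussian. *)
Lemma cond_densityE y u : cond_density U Y y u =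
  (gauss_mass precision)^-1 * gauss precision (u - ridge A (y - b)).
Proof.
rewrite /cond_density density_marginal joint_density_joint joint_pdfE.
rewrite /marginal_pdf_value; have := joint_const_gt0.
have := gauss_mass_gt0 posdef_precision.
have := expR_gt0 (- penalized_rss A (y - b) / (2 * s)).
move: (expR _) (gauss_mass _) joint_const (gauss _ _) => e m c w e0 m0 c0.
by field; rewrite !gt_eqF.
Qed.

Lemma cond_meanE y : cond_mean U Y y = ridge A (y - b).
Proof.
apply/colP => i; rewrite mxE /Rintegral.
under eq_integral do rewrite cond_densityE.
(* The bound holds with [C = s]: multiplying [precision] by [s] gives [gram], whose form dominates
   the squared norm. *)
rewrite (@integral_coord_gauss_shift _ _ _ _ _ s); first last.
- move=> x; rewrite /precision formZ form_gram mulrA divff ?gt_eqF// mul1r.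
  by apply: le_trans (sqr_coord_le_sqnorm x i) _; rewrite lerDr sqnorm_ge0.
- exact: ltW.
- exact: posdef_precision.
rewrite /= mulrAC mulVf ?mul1r// gt_eqF// gauss_mass_gt0//.
exact: posdef_precision.
Qed.

End model.

(** * Profiling out the variance *)

Section profile.
Context (R : realType).

Lemma eq_profile_out (l l' : R -> \bar R) :
  (forall s, 0 < s -> l s = l' s) -> profile_out l = profile_out l'.
Proof.
move=> ll; rewrite /profile_out; congr ereal_sup.
by apply/seteqP; split=> _ [s s0 <-]; exists s => //; rewrite ll.
Qed.

Lemma ln_gauss_mass k (M : 'M[R]_k) : posdef M ->
  ln (gauss_mass M) = (k%:R * ln (2 * pi) - ln (\det M)) / 2.
Proof.
move=> pM; have D0 := posdef_det_gt0 pM; have m0 := gauss_mass_gt0 pM.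
have pi2 : 0 < 2 * pi :> R by rewrite mulr_gt0// pi_gt0.
(* Squaring removes the square root before the logarithm is expanded. *)
have : ln (gauss_mass M ^+ 2) = k%:R * ln (2 * pi) - ln (\det M).
  rewrite sqr_sqrtr; last by rewrite divr_ge0 ?exprn_ge0 ?ltW.
  by rewrite ln_div ?posrE ?exprn_gt0// lnXn// -[ln _ *+ _]mulr_natl.
by rewrite lnXn// => <-; rewrite mulr2n; field.
Qed.

(** The factor [s ^+ q] in the determinant of the prior covariance cancels the one coming from
    [precision], so only [n] copies of [ln s] survive. *)
Lemma lne_marginal_pdf n q (A : 'M[R]_(n, q)) (b y : 'cV[R]_n) (s : R) : 0 < s ->
  lne (marginal_pdf_value A b s y)%:E =
  (- (n%:R / 2) * (ln (2 * pi) + ln s) - ln (\det (gram A)) / 2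
   - penalized_rss A (y - b) / (2 * s))%:E.
Proof.
move=> s0; have s'0 : 0 < s^-1 by rewrite invr_gt0.
have pn := posdef_scalar n s'0; have pq := posdef_scalar q s'0.
have pP := posdef_precision A s0.
have mn := gauss_mass_gt0 pn; have mq := gauss_mass_gt0 pq.
have mP := gauss_mass_gt0 pP; have e0 := expR_gt0 (- penalized_rss A (y - b) / (2 * s)).
have D0 := posdef_det_gt0 (posdef_gram A).
rewrite /marginal_pdf_value /joint_const lne_EFin; last first.
  by rewrite !mulr_gt0// invr_gt0.
congr EFin; set lp := ln (2 * pi).
rewrite !lnM ?posrE ?mulr_gt0 ?invr_gt0// expRK !lnV ?posrE//.
rewrite !ln_gauss_mass// -/lp !det_scalar detZ lnM ?posrE ?exprn_gt0//.
by rewrite !lnXn// !lnV ?posrE// -[_ *+ q]mulr_natl -[_ *+ n]mulr_natl; field; rewrite gt_eqF.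
Qed.

Lemma profile_out_normal (n : nat) (c g : R) : (0 < n)%N -> 0 <= g ->
  profile_out (fun s => (- (n%:R / 2) * (ln (2 * pi) + ln s) + c - g / (2 * s))%:E) =
  (c%:E - (n%:R / 2)%:E * (1 + lne (2 * pi * g / n%:R)%:E))%E.
Proof.
move=> n0; have n0' : 0 < n%:R :> R by rewrite ltr0n.
have pi2 : 0 < 2 * pi :> R by rewrite mulr_gt0// pi_gt0.
rewrite le_eqVlt => /orP[/eqP<-|g0].
  (* For [g = 0] both sides are [+oo]: the right one because [lne 0] is [-oo], the left one because
     the objective is unbounded as [s] tends to 0. *)
  rewrite mulr0 mul0r le0_lneNy// addeNy gt0_muleNy ?lte_fin ?divr_gt0//.
  rewrite (_ : - -oo = +oo)%E// addey//; apply/eqyP => M M0.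
  apply: ereal_sup_ubound.
  (* The value of [ln s] at which the objective equals [M]. *)
  pose l := - (2 / n%:R) * (M - c) - ln (2 * pi).
  exists (expR l); first exact: expR_gt0.
  by rewrite /l expRK mul0r; congr EFin; field; rewrite gt_eqF.
(* The zero of the derivative of the objective in [s]. *)
pose s0 := g / n%:R; have s00 : 0 < s0 by rewrite divr_gt0.
have -> : 2 * pi * g / n%:R = 2 * pi * s0 by rewrite mulrA.
rewrite lne_EFin; last exact: mulr_gt0.
have -> : ln (2 * pi * s0) = ln (2 * pi) + ln s0 by rewrite lnM ?posrE.
have valE : - (n%:R / 2) * (ln (2 * pi) + ln s0) + c - g / (2 * s0) =
    c - n%:R / 2 * (1 + (ln (2 * pi) + ln s0)).
  by rewrite /s0; field; rewrite !gt_eqF.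
transitivity (c - n%:R / 2 * (1 + (ln (2 * pi) + ln s0)))%:E; last first.
  by rewrite EFinB EFinM (EFinD 1).
rewrite -valE.
apply/eqP; rewrite eq_le; apply/andP; split; last first.
  by apply: ereal_sup_ubound; exists s0.
apply: ge_ereal_sup => _ [s /= s_gt0 <-]; rewrite lee_fin valE.
(* The gap is [n/2 (ln x - x + 1)] with [x = s0 / s]. *)
have : ln (s0 / s) <= s0 / s - 1.
  have := @le_ln1Dx R (s0 / s - 1); rewrite (addrC 1) subrK; apply.
  by rewrite ltrBrDl subrr divr_gt0.
rewrite ln_div ?posrE// => lnle.
have -> : g / (2 * s) = n%:R / 2 * (s0 / s).
  by rewrite /s0; field; rewrite !gt_eqF.
have : 0 <= n%:R / 2 * (s0 / s - 1 - (ln s0 - ln s)).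
  by rewrite mulr_ge0 ?divr_ge0 ?subr_ge0// ltW.
lra.
Qed.

End profile.

Theorem theorem2p1 (R : realType) (n p q m : nat)
    (hn : (1 <= n)%N) (hp : (1 <= p)%N) (hq : (1 <= q)%N)
    (X : 'M[R]_(n, p)) (Z : 'M[R]_(n, q))
    (Theta : set 'cV[R]_m) (Lambda L : 'cV[R]_m -> 'M[R]_q)
    (d : measure_display) (T : measurableType d)
    (P : 'cV[R]_p -> 'cV[R]_m -> R -> probability T R)
    (U : forall beta theta sigma2, {RV (P beta theta sigma2) >-> 'cV[R]_q})
    (eps Y : forall beta theta sigma2, {RV (P beta theta sigma2) >-> 'cV[R]_n})
    (hmodel : forall beta theta sigma2, Theta theta -> 0 < sigma2 ->
       linear_mixed_model X Z (Lambda theta) beta sigma2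
         (U beta theta sigma2) (eps beta theta sigma2) (Y beta theta sigma2))
    (hL : forall theta, Theta theta ->
       (L theta)^T *m L theta
       = (Z *m Lambda theta)^T *m (Z *m Lambda theta) + 1%:M)
    (y : 'cV[R]_n) (beta : 'cV[R]_p) (theta : 'cV[R]_m) (htheta : Theta theta)
    (sigma2 : R) (hsigma2 : 0 < sigma2) :
  let u := cond_mean (U beta theta sigma2) (Y beta theta sigma2) y in
  let g := enorm (y - X *m beta - Z *m Lambda theta *m u) ^+ 2
           + enorm u ^+ 2 in
  profile_out (fun s => loglik (Y beta theta s) y)
  = ((- (1 / 2) * ln (`|\det (L theta)| ^+ 2))%:E
     - (n%:R / 2)%:E * (1 + lne (2 * pi * g / n%:R)%:E))%E.
Proof.
move=> u g; pose A := Z *m Lambda theta; pose r := y - X *m beta.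
have uE : u = ridge A r.
  have [YE nU neps indep] := hmodel beta theta sigma2 htheta hsigma2.
  exact: (cond_meanE hsigma2 YE nU neps indep).
have gE : g = penalized_rss A r by rewrite /g !enorm_sqr uE.
(* The square of the determinant of [L] is the determinant of [L^T L]. *)
have detL : `|\det (L theta)| ^+ 2 = \det (gram A).
  by rewrite real_normK ?num_real// expr2 -{1}det_tr -det_mulmx hL.
rewrite gE detL -(profile_out_normal _ hn (penalized_rss_ge0 A r)).
apply: eq_profile_out => s s0.
(* The model is used anew at each [s], under its own probability; the ridge solution found at
   [sigma2] is the same for all of them. *)
have [YE nU neps indep] := hmodel beta theta s htheta s0.
rewrite /loglik (density_marginal s0 YE nU neps indep) lne_marginal_pdf//.
by congr EFin; rewrite -/r; field; rewrite gt_eqF.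
Qed.
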